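(* Let $\ell\in\mathbb{N}$ and let $v(x)$ be a real polynomial. The following are equivalent: (i) There exists a polynomial $w\in\mathbb{Q}[x]$ with $w(0)\in\mathbb{Z}$ such that $v-w$ is an odd polynomial of degree at most $2\ell-1$. (ii) For every $\epsilon>0$ there exists an integer $r\ge 2^\ell$ for which $\mathcal R(v,\epsilon)$ is a $\Delta_{\ell,r}^*$ set. (iii) For every $\epsilon>0$, $\mathcal R(v,\epsilon)$ is a $\Delta_\ell^*$ set.
   Context: $\mathbb{N}=\{1,2,\dots\}$; $\|x\|$ is the distance from $x$ to the nearest integer; $\mathcal R(v,\epsilon)=\{n\in\mathbb{N}:\|v(n)\|<\epsilon\}$. A polynomial is odd if it has the form $\sum_j a_jx^{2j-1}$ (i.e. $v(-x)=-v(x)$). Define $\partial:\bigcup_{\ell\ge1}\mathbb{Z}^{2^\ell}\to\mathbb{Z}$ recursively by $\partial(m_1,m_2)=m_2-m_1$ and $\partial(m_1,\dots,m_{2^\ell})=\partial(m_{2^{\ell-1}+1},\dots,m_{2^\ell})-\partial(m_1,\dots,m_{2^{\ell-1}})$ for $\ell>1$. For a finite or infinite sequence $(n_k)$ in $\mathbb{Z}$, $D_\ell((n_k))=\{\partial(n_{j_1},\dots,n_{j_{2^\ell}}): j_1<\dots<j_{2^\ell}\}$ (indices ranging over the index set of the sequence). For $r\ge2^\ell$, $E\subseteq\mathbb{N}$ is a $\Delta_{\ell,r}$ set if $D_\ell((n_k)_{k=1}^r)\subseteq E$ for some $r$-element sequence in $\mathbb{Z}$; $E$ is $\Delta_{\ell,r}^*$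 if it meets every $\Delta_{\ell,r}$ set. $E\subseteq\mathbb{N}$ is $\Delta_\ell^*$ if for every increasing sequence $(n_k)_{k\in\mathbb{N}}$ in $\mathbb{N}$, $E\cap D_\ell((n_k)_{k\in\mathbb{N}})\ne\emptyset$. *)

(* Defs.v *)
From HB Require Import structures.
From mathcomp Require Import all_boot all_order all_algebra.
From mathcomp Require Import all_classical all_reals.

Set Implicit Arguments.
Unset Strict Implicit.
Unset Printing Implicit Defensive.

Import Order.TTheory GRing.Theory Num.Theory.

Local Open Scope classical_set_scope.
Local Open Scope ring_scope.

(* The set {1, 2, ...}, as a set of integers: the sets D_l consist of integers,
   so all subsets of the positive naturals are handled inside int. *)
Definition posint : set int := [set n | 0 < n].

Definition dist_int (R : realType) (x : R) : R :=
  inf [set `|x - m%:~R| | m in [set: int]].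

Definition ret_set (R : realType) (v : {poly R}) (eps : R) : set int :=
  [set n | posint n /\ dist_int v.[n%:~R] < eps].

Definition odd_poly_form (R : realType) (p : {poly R}) : Prop :=
  exists (k : nat) (a : nat -> R),
    p = \sum_(1 <= j < k.+1) a j *: 'X^(2 * j - 1).

(* The operator on tuples of length 2^l, represented as sequences. Starting the
   recursion at l = 0 with the identity gives m_2 - m_1 for l = 1; see pdiff1
   and pdiffS. The value is only meaningful when size m = 2^l. *)
Fixpoint pdiff (l : nat) (m : seq int) : int :=
  if l is l'.+1 then
    pdiff l' (drop (2 ^ l') m) - pdiff l' (take (2 ^ l') m)
  else head 0 m.

Lemma pdiff1 (m1 m2 : int) : pdiff 1 [:: m1; m2] = m2 - m1.
Proof. by []. Qed.

Lemma pdiffS (l : nat) (s t : seq int) : size s = (2 ^ l)%N ->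
  pdiff l.+1 (s ++ t) = pdiff l t - pdiff l s.
Proof. by move=> sz /=; rewrite drop_size_cat // take_size_cat. Qed.

(* The index type I is 'I_r for a sequence with r terms and nat for an infinite
   sequence; strictly sorted sequences js are the choices j_1 < ... < j_{2^l}. *)
Definition Dset (d : Order.disp_t) (I : orderType d) (l : nat) (n : I -> int) :
    set int :=
  [set pdiff l (map n js) | js in
     [set js : seq I | size js = (2 ^ l)%N /\ sorted <%O js]].

Definition is_Delta (l r : nat) (E : set int) : Prop :=
  E `<=` posint /\ exists n : 'I_r -> int, Dset l n `<=` E.

Definition is_Delta_fin_star (l r : nat) (E : set int) : Prop :=
  E `<=` posint /\ forall F : set int, is_Delta l r F -> E `&` F !=set0.

Definition is_Delta_star (l : nat) (E : set int) : Prop :=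
  E `<=` posint /\
  forall n : nat -> int, (forall k, posint (n k)) ->
    {homo n : i j / (i < j)%N >-> i < j} ->
    E `&` Dset l n !=set0.

(* Main.v *)
Require Import Defs.
From HB Require Import structures.
From mathcomp Require Import all_boot all_order all_algebra.
From mathcomp Require Import all_classical all_reals.
From mathcomp Require Import ring lra zify.

Set Implicit Arguments.
Unset Strict Implicit.
Unset Printing Implicit Defensive.

Import Order.TTheory GRing.Theory Num.Theory.

Local Open Scope classical_set_scope.
Local Open Scope ring_scope.

(* Write T for the circle group R/Z. For an ultrafilter p on a commutative ring
   A, let D_l p be the law of the difference operator of 2^l successive choices
   from p, and for a character chi : A -> T let M_e chi be the character sending
   a to the limit of chi(a x^e) as x tends along p.

   Sufficiency. Expanding (y - x)^e expresses the operator M_e of D_1 p through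
   compositions of the operators M_(e - i) and M_i of p. If e is odd, then the
   pure terms cancel, while in each mixed term one of the exponents is odd and
   at most e - 2. By induction on l the operator M_e of D_l p is zero for all
   odd e < 2l. Applied to the ring A of integer sequences, this gives a bound r
   that is uniform over all finite sequences of integers.

   Necessity. Suppose (iii). If A = Z, then M_e acts on T by c |-> lim_p c n^e.
   A Ramsey argument shows that the limit of v along D_l p is 0 for each p
   containing all half-lines, and this limit is a sum of values of the M_e. The
   ultrafilters containing moreover all nonzero ideals form a semigroup, in
   which commutators realise every prescribed value of M_e at a non-torsion
   point with all lower M_i vanishing identically. The resulting choices of p
   force the constant coefficient of v to vanish in T, then the other even
   coefficients to be torsion, and finally also the odd ones of degree above
   2l - 1, whose contribution to the limit along D_l p has as lowest term an
   l-fold commutator of M_2 with an odd M_t. *)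

(** * The circle group *)

Section Torsion.
Variable V : zmodType.
Implicit Type g : V.

Definition torsion g : Prop := exists2 N : int, N != 0 & g *~ N = 0.

Lemma torsion0 : torsion 0.
Proof. by exists 1; rewrite ?mul0rz. Qed.

Lemma torsionN g : torsion g -> torsion (- g).
Proof. by move=> [N N0 gN]; exists N; rewrite // mulNrz gN oppr0. Qed.

Lemma torsionMz g (m : int) : torsion g -> torsion (g *~ m).
Proof. by move=> [N N0 gN]; exists N; rewrite // mulrzAC gN mul0rz. Qed.

Lemma torsion_mulrSn g (k : nat) : torsion (g *+ k.+1) -> torsion g.
Proof.
move=> [N N0 gkN]; exists (k.+1%:Z * N); first exact: mulf_neq0.
by rewrite mulrzA -pmulrn.
Qed.

End Torsion.

(* [Num.int_num_subdef] is the predicate behind [Num.int]; the subgroup structure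
   is attached to it. *)
Definition circle (R : realType) : Type :=
  {ideal_quot GRing.ZmodClosed.clone R (@Num.int_num_subdef R) _}.

HB.instance Definition _ (R : realType) := ZmodQuotient.on (circle R).

Definition to_circle (R : realType) (x : R) : circle R := \pi_(circle R)%qT x.

Lemma to_circle_is_zmod_morphism (R : realType) : zmod_morphism (@to_circle R).
Proof. exact: pi_is_zmod_morphism. Qed.

HB.instance Definition _ (R : realType) :=
  GRing.isZmodMorphism.Build R (circle R) (@to_circle R)
    (@to_circle_is_zmod_morphism R).

Section DistInt.
Variable R : realType.
Implicit Types (x d : R) (m : int).

Lemma dist_int_ltP x d : dist_int x < d <-> exists m, `|x - m%:~R| < d.
Proof.
split=> [/inf_lt[|_ [m _ <-] xm]|[m]]; last apply: le_lt_trans.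
- by exists `|x - 0%:~R|, 0.
- by exists m.
by apply: ge_inf; [exists 0 => _ [k _ <-]|exists m].
Qed.

Lemma dist_int_addz x m : dist_int (x + m%:~R) = dist_int x.
Proof.
congr (inf _); apply/seteqP; split=> _ [k _ <-] /=.
  by exists (k - m) => //; rewrite intrB; congr `|_|; ring.
by exists (k + m) => //; rewrite intrD; congr `|_|; ring.
Qed.

End DistInt.

Section Circle.
Variable R : realType.
Implicit Types (x y d : R) (s t : circle R).

Lemma to_circle_eq x y : to_circle x = to_circle y <-> x - y \is a Num.int.
Proof.
by rewrite [_ \is a _](Quotient.idealrBE _ x y); split=> [/eqP|/eqP].
Qed.

Lemma to_circle_eq0 x : to_circle x = 0 <-> x \is a Num.int.
Proof. by rewrite -(raddf0 (@to_circle R)) to_circle_eq subr0. Qed.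

Lemma to_circle_mulz x (m : int) : to_circle (x * m%:~R) = to_circle x *~ m.
Proof. by rewrite mulrzr raddfMz. Qed.

Lemma to_circle_addz x (m : int) : to_circle (x + m%:~R) = to_circle x.
Proof. by apply/to_circle_eq; rewrite addrAC subrr add0r. Qed.

Lemma to_circle_repr t : to_circle (repr t) = t.
Proof. exact: reprK. Qed.

Lemma circle_representative t : exists2 x, 0 <= x < 1 & t = to_circle x.
Proof.
exists (repr t - (Num.floor (repr t))%:~R).
  by have /andP[] := floor_itv (repr t); rewrite intrD; lra.
by rewrite -intrN to_circle_addz to_circle_repr.
Qed.

Lemma circle_divisible t (n : nat) : (0 < n)%N -> exists s, s *+ n = t.
Proof.
move=> n0; exists (to_circle (repr t / n%:R)).
rewrite -raddfMn /= -[X in to_circle X]mulr_natr.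
by rewrite divfK ?to_circle_repr // pnatr_eq0 -lt0n.
Qed.

Definition circle_norm t : R := dist_int (repr t).

Lemma circle_norm_to_circle x : circle_norm (to_circle x) = dist_int x.
Proof.
have /to_circle_eq/intrP[m] := to_circle_repr (to_circle x).
move=> /(canRL (subrK _)); rewrite /circle_norm addrC => ->.
exact: dist_int_addz.
Qed.

Lemma circle_norm_ltP t d :
  circle_norm t < d <-> exists2 x, t = to_circle x & `|x| < d.
Proof.
split=> [/dist_int_ltP[m repr_m]|[x ->] xd].
  exists (repr t - m%:~R) => //.
  by rewrite -intrN to_circle_addz to_circle_repr.
by rewrite circle_norm_to_circle; apply/dist_int_ltP; exists 0; rewrite subr0.
Qed.

Lemma circle_norm0_lt d : 0 < d -> circle_norm 0 < d.
Proof.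
by move=> d0; apply/circle_norm_ltP; exists 0; rewrite ?normr0 ?raddf0.
Qed.

Lemma circle_normN_lt t d : circle_norm t < d -> circle_norm (- t) < d.
Proof.
move=> /circle_norm_ltP[x -> xd]; apply/circle_norm_ltP.
by exists (- x); rewrite ?normrN ?raddfN.
Qed.

Lemma circle_norm_split s t d :
  circle_norm s < d / 2 -> circle_norm t < d / 2 -> circle_norm (s + t) < d.
Proof.
move=> /circle_norm_ltP[x -> xd] /circle_norm_ltP[y -> yd].
apply/circle_norm_ltP; exists (x + y); first by rewrite raddfD.
by rewrite (le_lt_trans (ler_normD _ _)) // [d]splitr ltrD.
Qed.

Lemma circle_norm_eq0 t : (forall d, 0 < d -> circle_norm t < d) -> t = 0.
Proof.
have [y /andP[y_ge0 y_lt1] ->] := circle_representative t => small_t.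
have [->|y_neq0] := eqVneq y 0; first exact: raddf0.
have /small_t/circle_norm_ltP[x] : 0 < Num.min y (1 - y).
  by rewrite lt_min subr_gt0 y_lt1 lt_def y_neq0 y_ge0.
move=> /to_circle_eq/intrP[m /(canRL (subrK _)) y_eq].
rewrite lt_min !ltr_norml => /andP[/andP[x1 x2] /andP[x3 x4]].
have : (0 : int)%:~R < m%:~R :> R by lra.
have : m%:~R < (1 : int)%:~R :> R by lra.
by rewrite !ltr_int; lia.
Qed.

Lemma torsion_to_circle_rat (q : rat) : torsion (to_circle (ratr q : R)).
Proof.
exists (denq q); first exact: denq_neq0.
rewrite -to_circle_mulz; apply/to_circle_eq0/intrP; exists (numq q).
by rewrite /ratr divfK // intr_eq0 denq_neq0.
Qed.

Lemma torsion_to_circleP x :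
  torsion (to_circle x) <-> exists q : rat, x = ratr q.
Proof.
split=> [[N N0]|[q ->]]; last exact: torsion_to_circle_rat.
rewrite -to_circle_mulz => /to_circle_eq0/intrP[m xN].
exists (m%:~R / N%:~R); rewrite fmorph_div /= !ratr_int -xN mulfK //.
by rewrite intr_eq0.
Qed.

Lemma torsion_mulz_neq0 (K : int) :
  K != 0 -> exists2 t : circle R, torsion t & t *~ K <> 0.
Proof.
move=> K0; have K0' : K%:~R != 0 :> R by rewrite intr_eq0.
exists (to_circle (2 * K%:~R)^-1).
  apply/torsion_to_circleP; exists ((2 * K)%:~R^-1).
  by rewrite fmorphV /= ratr_int intrM.
rewrite -to_circle_mulz => /to_circle_eq0/intrP[m].
rewrite invfM -mulrA mulVf // mulr1 => half_int.
have /intr_inj : (2 * m)%:~R = 1%:~R :> R.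
  by rewrite intrM -half_int mulfV ?pnatr_eq0.
by lia.
Qed.

Lemma torsion_dense s (k : nat) :
  exists t, torsion t /\ circle_norm (t - s) < k.+1%:R^-1.
Proof.
set y := repr s; have k0 : k.+1%:R != 0 :> R by rewrite pnatr_eq0.
pose q : rat := (Num.floor (y * k.+1%:R))%:~R / k.+1%:R.
exists (to_circle (ratr q)); split; first exact: torsion_to_circle_rat.
rewrite -[s]to_circle_repr -/y -raddfB circle_norm_to_circle.
apply/dist_int_ltP; exists 0; rewrite subr0 fmorph_div /= ratr_int ratr_nat.
rewrite -[X in _ - X](mulfK k0) -mulrBl normrM [`|_^-1|]ger0_norm ?invr_ge0 //.
rewrite gtr_pMl ?invr_gt0 // ltr_norml.
by have /andP[] := floor_itv (y * k.+1%:R); rewrite intrD; lra.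
Qed.

Lemma exists_circle_multiple_near s t d : t != 0 -> circle_norm t < d ->
  exists2 k : int, 0 < k & circle_norm (t *~ k - s) < d.
Proof.
move=> t_neq0 /circle_norm_ltP[x t_eq].
have x_neq0 : x != 0 by apply: contraNneq t_neq0 => x0; rewrite t_eq x0 raddf0.
wlog x_gt0 : x s t {t_neq0} t_eq x_neq0 / 0 < x => [positive_case|xd].
  have [|x_le0] := ltP 0 x; first exact: positive_case.
  rewrite -normrN => /(positive_case (- x) (- s) (- t)) [].
  - by rewrite t_eq raddfN.
  - by rewrite oppr_eq0.
  - by rewrite oppr_gt0 lt_neqAle x_neq0.
  move=> k k0 /circle_normN_lt; rewrite mulNrz opprB addrC !opprK.
  by exists k.
pose y := repr s; pose b := Num.ceil (x - y).
pose k := Num.floor ((y + b%:~R) / x).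
have y_b : y + b%:~R >= x by have := ceil_ge (x - y); rewrite -/b; lra.
have /andP[] := floor_itv ((y + b%:~R) / x); rewrite -/k.
rewrite ler_pdivlMr // ltr_pdivrMr // intrD mulrDl mul1r => k_le k_gt.
exists k; first by rewrite floor_gt0 ler_pdivlMr ?mul1r.
rewrite t_eq -to_circle_mulz -[s]to_circle_repr -/y -(to_circle_addz y b).
rewrite -raddfB.
apply/circle_norm_ltP; exists (x * k%:~R - (y + b%:~R)) => //.
apply: le_lt_trans xd; rewrite [`|x|]gtr0_norm // ler_norml.
by apply/andP; split; lra.
Qed.

End Circle.

(** * Ultrafilters and limits in the circle *)

Lemma ultrafilter_setVsetC (T : Type) (F : set_system T) :
  ProperFilter F -> (forall A, F A \/ F (~` A)) -> UltraFilter F.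
Proof.
move=> FF F_or_setC; split=> // G GF FG; apply/seteqP; split=> // A GA.
have [//|/FG GnA] := F_or_setC A.
have : G set0 by rewrite -(setICr A); exact: filterI.
by move=> /(filter_not_empty G).
Qed.

Structure ultrafilter_on (T : Type) := UltraFilterPack {
  ultrafilter :> set T -> Prop;
  ultrafilter_class : UltraFilter ultrafilter }.

#[global] Existing Instance ultrafilter_class.

Section Ultrafilters.
Variables I J : Type.
Implicit Types (U : ultrafilter_on I) (F : I -> ultrafilter_on J).

Lemma ultrafilter_eq U U' : U = U' :> set_system I -> U = U'.
Proof.
case: U U' => [U Uc] [U' U'c] /= UU'; subst U'.
by congr UltraFilterPack; exact: Prop_irrelevance.
Qed.

Definition ultra_principal (x : I) : ultrafilter_on I :=
  UltraFilterPack (principal_filter_ultra x).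

Lemma bind_ultrafilter U F : UltraFilter [set A | U [set i | F i A]].
Proof.
apply: ultrafilter_setVsetC => [|A].
  split=> /= [/filter_ex[i]|]; first exact: filter_not_empty.
  split=> [/=|A B /=|A B AB /=].
  - by apply: filterE => i; exact: filterT.
  - by apply: filterS2 => i; exact: filterI.
  - by apply: filterS => i; exact: filterS.
have [|UnA] := in_ultra_setVsetC [set i | F i A] (ultrafilter_class U).
  by left.
right; apply: filterS UnA => i nFA.
by have [] := in_ultra_setVsetC A (ultrafilter_class (F i)).
Qed.

Definition ultra_bind U F : ultrafilter_on J :=
  UltraFilterPack (bind_ultrafilter U F).

End Ultrafilters.

Definition ultra_map (I J : Type) (f : I -> J) (U : ultrafilter_on I) :
    ultrafilter_on J :=
  ultra_bind U (fun i => ultra_principal (f i)).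

Lemma ultra_mapE (I J : Type) (f : I -> J) (U : ultrafilter_on I) (A : set J) :
  ultra_map f U A = U (f @^-1` A).
Proof.
apply/propext; rewrite /ultra_map /=.
by split; apply: filterS => i /=; rewrite principal_filterP.
Qed.

Lemma ultra_map_id (I : Type) (U : ultrafilter_on I) : ultra_map id U = U.
Proof. by apply/ultrafilter_eq/funext => A; rewrite ultra_mapE. Qed.

Lemma ultra_finite_constant (I : Type) (T : finType) (U : ultrafilter_on I)
  (f : I -> T) : exists c, U [set i | f i = c].
Proof.
apply: contrapT => no_c; have : U [set i | forall c, f i <> c].
  apply: filter_forall => c.
  have [fc|//] := in_ultra_setVsetC [set i | f i = c] (ultrafilter_class U).
  by case: no_c; exists c.
by move=> /filter_ex[i /(_ (f i))].
Qed.

Lemma ultra_residue (I : Type) (U : ultrafilter_on I) (f : I -> int) (N : int) :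
  N != 0 -> exists c, U [set i | (N %| f i - c)%Z].
Proof.
move=> N0; have residue_lt i : (`|(f i %% N)%Z| < `|N|)%N.
  by rewrite -ltz_nat gez0_abs ?modz_ge0 // abszE ltz_mod.
have [c Uc] := ultra_finite_constant U (fun i => Ordinal (residue_lt i)).
exists (c : nat)%:Z; apply: filterS Uc => i /= <-.
by rewrite /= gez0_abs ?modz_ge0 // -eqz_mod_dvd modz_mod.
Qed.

Lemma exists_ultra_infty :
  exists U : ultrafilter_on nat, \oo `<=` ultrafilter U.
Proof.
have [U [Uultra ooU]] := ultraFilterLemma eventually_filter.
by exists (UltraFilterPack Uultra).
Qed.

Definition ultra_infty : ultrafilter_on nat := projT1 (cid exists_ultra_infty).

Lemma ultra_infty_gt (N : nat) : ultra_infty [set n | (N < n)%N].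
Proof.
by rewrite /ultra_infty; case: cid => U /= ooU; apply: ooU; exists N.+1.
Qed.

Lemma ulim_exists (R : realType) (I : Type) (U : ultrafilter_on I)
    (f : I -> circle R) :
  exists t, forall d : R, 0 < d -> U [set i | circle_norm (f i - t) < d].
Proof.
have /choice[rep repP] : forall i, exists x, 0 <= x < 1 /\ f i = to_circle x.
  by move=> i; have [x x01 ->] := circle_representative (f i); exists x.
pose E := [set x : R | U [set i | x <= rep i]].
have E0 : E 0 by apply: filterE => i; have [/andP[]] := repP i.
have E_ub : ubound E 1.
  move=> x /filter_ex[i /= x_le]; have [/andP[_ /ltW rep_le1] _] := repP i.
  exact: le_trans rep_le1.
have E_sup : has_sup E by split; [exists 0|exists 1].
exists (to_circle (sup E)) => d d0; have [x Ex x_gt] := sup_adherent d0 E_sup.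
have nE : ~ E (sup E + d).
  by move=> /(ub_le_sup E_sup.2); rewrite gerDl leNgt d0.
have [//|] :=
  in_ultra_setVsetC [set i | sup E + d <= rep i] (ultrafilter_class U).
apply: filterS2 Ex => i /= x_le /negP; rewrite -ltNge => rep_lt.
have [_ ->] := repP i; rewrite -raddfB; apply/circle_norm_ltP.
by exists (rep i - sup E) => //; rewrite ltr_norml; apply/andP; split; lra.
Qed.

HB.lock Definition ulim (R : realType) (I : Type) (U : ultrafilter_on I)
    (f : I -> circle R) : circle R :=
  projT1 (cid (ulim_exists U f)).

Lemma mulrzfctE (T : Type) (V : zmodType) (f : T -> V) (k : int) (x : T) :
  (f *~ k) x = f x *~ k.
Proof. by case: k => k; rewrite /intmul ?opprfctE natmulfctE. Qed.

Section Ulim.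
Variable R : realType.
Implicit Types (t : circle R) (d : R).

Section UlimTheory.
Variables (I : Type) (U : ultrafilter_on I).
Implicit Types f g : I -> circle R.

Lemma ulimP f d : 0 < d -> U [set i | circle_norm (f i - ulim U f) < d].
Proof. by rewrite ulim.unlock; case: cid => t /= f_t /f_t. Qed.

Lemma ulim_unique f t :
  (forall d, 0 < d -> U [set i | circle_norm (f i - t) < d]) -> ulim U f = t.
Proof.
move=> f_t; apply/eqP; rewrite -subr_eq0; apply/eqP/circle_norm_eq0 => d d0.
have d20 : 0 < d / 2 by rewrite divr_gt0.
have [i [/= /circle_normN_lt]] := filter_ex (filterI (ulimP f d20) (f_t _ d20)).
rewrite opprB => norm_lim norm_t.
by have := circle_norm_split norm_lim norm_t; rewrite addrA subrK.
Qed.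

Lemma near_eq_ulim f g : U [set i | f i = g i] -> ulim U f = ulim U g.
Proof.
move=> fg; apply: ulim_unique => d /(ulimP g).
by apply: filterS2 fg => i /= ->.
Qed.

Lemma eq_ulim f g : f =1 g -> ulim U f = ulim U g.
Proof. by move=> /funext ->. Qed.

Lemma ulim_cst t : ulim U (fun=> t) = t.
Proof.
apply: ulim_unique => d d0; apply: filterE => i /=.
by rewrite subrr circle_norm0_lt.
Qed.

Lemma near_eq0_ulim f : U [set i | f i = 0] -> ulim U f = 0.
Proof. by move=> /(@near_eq_ulim _ (fun=> 0)) ->; exact: ulim_cst. Qed.

Lemma ulim_eq0 f : (forall i, f i = 0) -> ulim U f = 0.
Proof. by move=> f0; apply: near_eq0_ulim; exact: filterE. Qed.

Lemma ulim_is_zmod_morphism : zmod_morphism (@ulim R I U).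
Proof.
move=> f g; apply: ulim_unique => d d0.
have d20 : 0 < d / 2 by rewrite divr_gt0.
apply: filterS2 (ulimP f d20) (ulimP g d20) => i /= norm_f.
move=> /circle_normN_lt norm_g.
have := circle_norm_split norm_f norm_g.
by rewrite [(f - g) i]/(f i - g i) !opprD !opprK addrACA.
Qed.

HB.instance Definition _ := GRing.isZmodMorphism.Build (I -> circle R)
  (circle R) (@ulim R I U) ulim_is_zmod_morphism.

Lemma ulimMz f (k : int) : ulim U (fun i => f i *~ k) = ulim U f *~ k.
Proof.
by rewrite -raddfMz; apply: eq_ulim => i; rewrite mulrzfctE.
Qed.

Lemma ulimMn f (k : nat) : ulim U (fun i => f i *+ k) = ulim U f *+ k.
Proof. by rewrite -raddfMn; apply: eq_ulim => i; rewrite natmulfctE. Qed.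

Lemma ulim_sum (J : Type) (r : seq J) (P : {pred J}) (f : J -> I -> circle R) :
  ulim U (fun i => \sum_(j <- r | P j) f j i) =
  \sum_(j <- r | P j) ulim U (f j).
Proof. by rewrite -raddf_sum; apply: eq_ulim => i; rewrite fct_sumE. Qed.

End UlimTheory.

Lemma ulim_bind (I J : Type) (U : ultrafilter_on I) (F : I -> ultrafilter_on J)
    (f : J -> circle R) :
  ulim (ultra_bind U F) f = ulim U (fun i => ulim (F i) f).
Proof.
apply: ulim_unique => d d0; have d20 : 0 < d / 2 by rewrite divr_gt0.
apply: filterS (ulimP U (fun i => ulim (F i) f) d20) => i /= norm_i.
apply: filterS (ulimP (F i) f d20) => j /= norm_j.
by have := circle_norm_split norm_j norm_i; rewrite addrA subrK.
Qed.

Lemma ulim_principal (I : Type) (x : I) (f : I -> circle R) :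
  ulim (ultra_principal x) f = f x.
Proof.
apply: ulim_unique => d d0; apply/principal_filterP => /=.
by rewrite subrr circle_norm0_lt.
Qed.

Lemma ulim_map (I J : Type) (h : I -> J) (U : ultrafilter_on I)
    (f : J -> circle R) : ulim (ultra_map h U) f = ulim U (f \o h).
Proof. by rewrite ulim_bind; apply: eq_ulim => i; rewrite ulim_principal. Qed.

Lemma ulim_infty_eq (f : nat -> circle R) t :
  (forall k, circle_norm (f k - t) < k.+1%:R^-1) -> ulim ultra_infty f = t.
Proof.
move=> f_t; apply: ulim_unique => d d0.
apply: filterS (ultra_infty_gt (Num.bound d^-1)) => k /= k_gt.
apply: lt_le_trans (f_t k) _; rewrite -[d]invrK lef_pV2 ?posrE ?invr_gt0 //.
have /archi_boundP/ltW/le_trans -> // : 0 <= d^-1 by rewrite invr_ge0 ltW.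
by rewrite ler_nat ltnW // ltnW.
Qed.

End Ulim.

(** * Difference operators on ultrafilters *)

Section UltraDiff.
Variable A : zmodType.
Implicit Types (p q : ultrafilter_on A) (B : set A).

Definition ultra_add p q : ultrafilter_on A :=
  ultra_bind p (fun x => ultra_map (+%R x) q).

Definition ultra_opp p : ultrafilter_on A := ultra_map -%R p.

Definition ultra_diff1 p : ultrafilter_on A := ultra_add (ultra_opp p) p.

(* The law of the difference operator applied to 2^l successive choices from
   [p], later choices being made in dependence on the earlier ones. *)
Definition ultra_diff (l : nat) p : ultrafilter_on A := iter l ultra_diff1 p.

Lemma ultra_diffS l p : ultra_diff l.+1 p = ultra_diff1 (ultra_diff l p).
Proof. by []. Qed.

Lemma ultra_addE p q B : ultra_add p q B = p [set x | q [set y | B (x + y)]].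
Proof.
by congr (ultrafilter p _); apply/funext => x; exact: ultra_mapE.
Qed.

Lemma ultra_diffSE l p B : ultra_diff l.+1 p B =
  ultra_diff l p [set x | ultra_diff l p [set y | B (y - x)]].
Proof.
rewrite ultra_diffS /ultra_diff1 ultra_addE ultra_mapE.
congr (ultrafilter _ _); apply/funext => x; congr (ultrafilter _ _).
by apply/funext => y; rewrite /= addrC.
Qed.

Fixpoint seq_diff (l : nat) (s : seq A) : A :=
  if l is l'.+1 then
    seq_diff l' (drop (2 ^ l') s) - seq_diff l' (take (2 ^ l') s)
  else head 0 s.

End UltraDiff.

Lemma pdiffE (l : nat) (s : seq int) : pdiff l s = seq_diff l s.
Proof. by elim: l s => //= l IH s; rewrite !IH. Qed.

Lemma seq_diff_fct (I : Type) (A : zmodType) (l : nat) (s : seq (I -> A))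
    (i : I) :
  seq_diff l s i = seq_diff l (map (fun x => x i) s).
Proof.
elim: l s => [|l IH] s /=; first by case: s.
by rewrite -map_drop -map_take -!IH.
Qed.

Section NearSeq.
Variables (I : Type) (U : ultrafilter_on I).
Implicit Types P Q : seq I -> Prop.

Fixpoint near_seq (m : nat) P : Prop :=
  if m is m'.+1 then U [set k | near_seq m' (fun s => P (k :: s))] else P [::].

Lemma sub_near_seq m P Q : (forall s, size s = m -> P s -> Q s) ->
  near_seq m P -> near_seq m Q.
Proof.
elim: m P Q => [|m IH] P Q PQ /=; first exact: PQ.
by apply: filterS => k; apply: IH => s sm; apply: PQ; rewrite /= sm.
Qed.

Lemma near_seq_cat m n P :
  near_seq m (fun s => near_seq n (fun t => P (s ++ t))) -> near_seq (m + n) P.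
Proof.
elim: m P => [|m IH] P //=.
by apply: filterS => k; exact: (IH (fun s => P (k :: s))).
Qed.

Lemma ultra_diff_near_seq (A : zmodType) (n : I -> A) (l : nat) (B : set A) :
  ultra_diff l (ultra_map n U) B ->
  near_seq (2 ^ l) (fun s => B (seq_diff l (map n s))).
Proof.
elim: l B => [|l IH] B; first by have := ultra_mapE n U B => /= ->.
rewrite ultra_diffSE => /IH diff_x.
rewrite expnS mul2n -addnn; apply: near_seq_cat.
apply: sub_near_seq diff_x => s sz_s.
move=> /IH; apply: sub_near_seq => t _.
by rewrite /= map_cat drop_size_cat ?take_size_cat ?size_map.
Qed.

End NearSeq.

Lemma exists_seq_extension (T : Type) (P : seq T -> Prop) : P [::] ->
  (forall c, P c -> exists x, P (rcons c x)) ->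
  exists e : nat -> T, forall k, P (mkseq e k).
Proof.
move=> P0 PS.
have next (c : {c | P c}) :
    {c' : {c | P c} | exists x, sval c' = rcons (sval c) x}.
  apply: cid; case: c => c Pc; have [x Px] := PS _ Pc.
  by exists (exist _ _ Px), x.
have [f [f0 fS]] := dependent_choice next (exist _ _ P0).
have [e fE] := choice fS; exists e => k.
suff -> : mkseq e k = sval (f k) by case: (f k).
elim: k => [|k IH]; first by rewrite f0.
by rewrite fE -IH mkseqS.
Qed.

Lemma sorted_ltn_mask (js : seq nat) (k : nat) :
  sorted ltn js -> all (ltn^~ k) js ->
  exists2 b, size b = k & js = mask b (iota 0 k).
Proof.
move=> js_sorted /allP js_lt; have : subseq js (iota 0 k).
  rewrite (_ : js = [seq j <- iota 0 k | j \in js]); first exact: filter_subseq.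
  apply: (irr_sorted_eq ltn_trans ltnn) => //.
    exact: (sorted_filter ltn_trans) (iota_ltn_sorted 0 k).
  move=> j; rewrite mem_filter mem_iota add0n.
  by case: (boolP (j \in js)) => // /js_lt.
by move=> /subseqP[b]; rewrite size_iota; exists b.
Qed.

Section Ramsey.
Variables (I : Type) (U : ultrafilter_on I) (lt : rel I).
Variables (m : nat) (P : seq I -> Prop).

Definition near_extendable (c : seq I) : Prop :=
  forall b, size b = size c -> (size (mask b c) <= m)%N ->
    near_seq U (m - size (mask b c)) (fun t => P (mask b c ++ t)).

Lemma near_extendable_rcons (c : seq I) : near_extendable c ->
  U [set x | near_extendable (rcons c x)].
Proof.
move=> ext_c.
have : U [set x | forall b : (size c).-tuple bool, (size (mask b c) < m)%N ->
    near_seq U (m - (size (mask b c)).+1)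
      (fun t => P (rcons (mask b c) x ++ t))].
  apply: filter_forall => b.
  have [sz_lt|_] := ltnP (size (mask b c)) m; last exact: filterE.
  have := ext_c b (size_tuple b) (ltnW sz_lt); rewrite -(subnSK sz_lt) /=.
  apply: filterS => x + _; apply: sub_near_seq => t _.
  by rewrite cat_rcons.
apply: filterS => x /= ext_x.
elim/last_ind => [|b j _]; first by rewrite size_rcons.
rewrite !size_rcons => -[sz_b]; rewrite mask_rcons //.
case: j; last by rewrite cats0; exact: ext_c.
have /eqP sz_b' := sz_b.
by rewrite /= cats1 size_rcons => /(ext_x (Tuple sz_b')).
Qed.

Lemma ramsey_near_seq :
  (forall i, U [set k | lt i k]) -> near_seq U m P ->
  exists e : nat -> I, {homo e : i j / (i < j)%N >-> lt i j} /\
    forall js, sorted ltn js -> size js = m -> P (map e js).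
Proof.
move=> lt_U P_U.
have [||e eP] :=
  @exists_seq_extension I (fun c => pairwise lt c /\ near_extendable c).
- by split=> // b /size0nil ->; rewrite subn0.
- move=> c [c_lt ext_c]; have all_lt : U [set x | all (lt^~ x) c].
    elim: (c) => [|i c' IH]; first exact: filterE.
    by apply: filterS2 (lt_U i) IH => x /= -> ->.
  have [x [/= c_x ext_x]] :=
    filter_ex (filterI all_lt (near_extendable_rcons ext_c)).
  by exists x; rewrite pairwise_rcons c_x c_lt.
exists e; split=> [i j ij|js js_sorted sz_js].
  have [+ _] := eP j.+1; rewrite mkseqS pairwise_rcons.
  move=> /andP[/(all_nthP (e 0%N))/(_ i) + _].
  by rewrite size_mkseq nth_mkseq //; apply.
pose k := (\max_(j <- js) j).+1.
have [|b sz_b js_eq] := sorted_ltn_mask (k := k) js_sorted.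
  by apply/allP => j j_js; rewrite /= /k ltnS (big_rem j) //= leq_maxl.
have [_ /(_ b)] := eP k; rewrite -map_mask -js_eq size_map sz_js size_mkseq.
by move=> /(_ sz_b (leqnn _)); rewrite subnn /= cats0.
Qed.

End Ramsey.

Lemma ramsey_ultra_diff (I : Type) (A : zmodType) (U : ultrafilter_on I)
    (lt : rel I) (n : I -> A) (l : nat) (B : set A) :
  (forall i, U [set k | lt i k]) -> ultra_diff l (ultra_map n U) B ->
  exists e : nat -> I, {homo e : i j / (i < j)%N >-> lt i j} /\
    forall js, sorted ltn js -> size js = (2 ^ l)%N ->
      B (seq_diff l (map (n \o e) js)).
Proof.
move=> lt_U /ultra_diff_near_seq/(ramsey_near_seq lt_U)[e [e_lt eP]].
by exists e; split=> // js js_sorted sz_js; rewrite map_comp; exact: eP.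
Qed.

(** * Moments *)

Lemma big_ord_ends (V : nmodType) (n : nat) (F : nat -> V) :
  (0 < n)%N -> (forall i, (0 < i < n)%N -> F i = 0) ->
  \sum_(i < n.+1) F i = F 0%N + F n.
Proof.
case: n => // n _ F0.
rewrite big_ord_recl big_ord_recr /= big1 ?add0r // => i _.
by apply: F0; rewrite /bump /= add1n ltnS ltn_ord.
Qed.

Section CharMoment.
Variables (R : realType) (A : comPzRingType).
Implicit Types (p q : ultrafilter_on A) (chi : {additive A -> circle R}).

Definition char_moment p (e : nat) (chi : A -> circle R) : A -> circle R :=
  fun a => ulim p (fun x => chi (a * x ^+ e)).

Lemma char_moment_is_zmod_morphism p e chi :
  zmod_morphism (char_moment p e chi).
Proof.
by move=> a b; rewrite -raddfB; apply: eq_ulim => x; rewrite mulrBl raddfB.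
Qed.

HB.instance Definition _ p e chi := GRing.isZmodMorphism.Build A (circle R)
  (char_moment p e chi) (char_moment_is_zmod_morphism p e chi).

Lemma char_moment0 p e : char_moment p e 0 = 0.
Proof. by apply/funext => a; exact: ulim_cst. Qed.

Lemma char_moment_exp0 p (chi : A -> circle R) : char_moment p 0 chi = chi.
Proof.
apply/funext => a; rewrite -[RHS](ulim_cst p).
by apply: eq_ulim => x; rewrite mulr1.
Qed.

Lemma char_moment_opp p e chi :
  char_moment (ultra_opp p) e chi = char_moment p e chi *~ (-1) ^+ e.
Proof.
apply/funext => a; rewrite mulrzfctE -ulimMz /char_moment ulim_map.
apply: eq_ulim => x /=; rewrite [in LHS]exprNn mulrCA -raddfMz; congr (chi _).
by rewrite -mulrzl rmorphXn rmorphN1.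
Qed.

Lemma char_moment_add p q e chi :
  char_moment (ultra_add p q) e chi =
  \sum_(i < e.+1) char_moment p (e - i) (char_moment q i chi) *+ 'C(e, i).
Proof.
apply/funext => a; rewrite fct_sumE /char_moment ulim_bind.
under [RHS]eq_bigr => i _ do rewrite natmulfctE -ulimMn.
rewrite -(ulim_sum p _ _ (fun (i : 'I_e.+1) x =>
  ulim q (fun y => chi (a * x ^+ (e - i) * y ^+ i)) *+ 'C(e, i))).
apply: eq_ulim => x; rewrite ulim_map.
under [RHS]eq_bigr => i _ do rewrite -ulimMn.
rewrite -(ulim_sum q _ _ (fun (i : 'I_e.+1) y =>
  chi (a * x ^+ (e - i) * y ^+ i) *+ 'C(e, i))).
apply: eq_ulim => y /=; rewrite exprDn mulr_sumr raddf_sum.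
by apply: eq_bigr => i _; rewrite -raddfMn mulrnAr mulrA.
Qed.

Lemma char_moment_add_ends p q e chi : (0 < e)%N ->
  (forall i, (0 < i < e)%N ->
     char_moment p (e - i) (char_moment q i chi) = 0) ->
  char_moment (ultra_add p q) e chi = char_moment p e chi + char_moment q e chi.
Proof.
move=> e0 mixed0; rewrite char_moment_add.
pose F i := char_moment p (e - i) (char_moment q i chi) *+ 'C(e, i).
rewrite (big_ord_ends (F := F)) // => [|i /mixed0]; last first.
  by rewrite /F => ->; rewrite mul0rn.
by rewrite /F bin0 binn !mulr1n subn0 subnn !char_moment_exp0.
Qed.

Definition odd_char_moments_vanish p (t : nat) : Prop :=
  forall chi e, odd e -> (e < t)%N -> char_moment p e chi = 0.

(* The pure terms in the expansion of (y - x)^e cancel since e is odd, and in a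
   mixed term x^i y^(e - i) one of the exponents is odd and at most e - 2. *)
Lemma odd_char_moments_vanish_diff1 p t :
  odd_char_moments_vanish p t -> odd_char_moments_vanish (ultra_diff1 p) t.+2.
Proof.
move=> p0 chi e odd_e lt_e; have e_gt0 : (0 < e)%N by case: (e) odd_e.
rewrite /ultra_diff1 char_moment_add_ends // => [|i /andP[i_gt0 i_lt]].
  by rewrite char_moment_opp -signr_odd odd_e mulrN1z addNr.
rewrite char_moment_opp /=; have [odd_i|even_i] := boolP (odd i).
  rewrite (p0 _ i) ?char_moment0 ?mul0rz //.
  by move: odd_e odd_i i_lt lt_e; lia.
rewrite (p0 _ (e - i)%N) ?mul0rz //; first by rewrite oddB ?odd_e // ltnW.
by move: even_i i_gt0 lt_e; lia.
Qed.

Lemma odd_char_moments_vanish_diff p t m :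
  odd_char_moments_vanish p t ->
  odd_char_moments_vanish (ultra_diff m p) (t + m.*2).
Proof.
move=> p0; elim: m => [|m IH]; first by rewrite addn0.
by rewrite doubleS !addnS ultra_diffS; exact: odd_char_moments_vanish_diff1.
Qed.

End CharMoment.

Section Moment.
Variable R : realType.
Implicit Types (p q : ultrafilter_on int) (c g : circle R).

Definition moment p (e : nat) c : circle R := ulim p (fun n => c *~ n ^+ e).

Lemma moment_is_zmod_morphism p e : zmod_morphism (moment p e).
Proof.
by move=> c d; rewrite -raddfB; apply: eq_ulim => n; rewrite mulrzBl.
Qed.

HB.instance Definition _ p e := GRing.isZmodMorphism.Build (circle R) (circle R)
  (moment p e) (moment_is_zmod_morphism p e).

Lemma char_moment_intmul p e c :
  char_moment p e ( *~%R c) = *~%R (moment p e c).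
Proof.
apply/funext => a; rewrite -ulimMz; apply: eq_ulim => n.
by rewrite mulrC mulrzA.
Qed.

Lemma moment_exp0 p c : moment p 0 c = c.
Proof. by rewrite /moment (eq_ulim _ (g := fun=> c)) ?ulim_cst. Qed.

Lemma moment_add p q e c : moment (ultra_add p q) e c =
  \sum_(i < e.+1) moment p (e - i) (moment q i c) *+ 'C(e, i).
Proof.
rewrite -[LHS]mulr1z -char_moment_intmul char_moment_add fct_sumE.
apply: eq_bigr => i _.
by rewrite natmulfctE !char_moment_intmul mulr1z.
Qed.

Lemma moment_opp p e c : moment (ultra_opp p) e c = moment p e c *~ (-1) ^+ e.
Proof.
rewrite -[LHS]mulr1z -char_moment_intmul char_moment_opp mulrzfctE.
by rewrite char_moment_intmul mulr1z.
Qed.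

Lemma moment_diff1 p e c : moment (ultra_diff1 p) e c = \sum_(i < e.+1)
  moment p (e - i) (moment p i c) *~ (-1) ^+ (e - i) *+ 'C(e, i).
Proof. by rewrite moment_add; apply: eq_bigr => i _; rewrite moment_opp. Qed.

Definition odd_moments_vanish p (t : nat) : Prop :=
  forall e c, odd e -> (e < t)%N -> moment p e c = 0.

Lemma odd_moments_vanish_diff p t m :
  odd_moments_vanish p t -> odd_moments_vanish (ultra_diff m p) (t + m.*2).
Proof.
move=> p0 e c odd_e lt_e; rewrite -[LHS]mulr1z -char_moment_intmul.
rewrite (odd_char_moments_vanish_diff _ _ odd_e lt_e) // => chi e' odd_e' lt_e'.
have -> : chi = *~%R (chi 1) :> (int -> circle R).
  by apply/funext => n; rewrite -raddfMz intz.
by rewrite char_moment_intmul p0 //; apply/funext => n; exact: mul0rz.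
Qed.

End Moment.

(** * Sufficiency *)

Section CoefficientCondition.
Variable R : realType.
Implicit Types (v p : {poly R}) (l i : nat).

Definition low_odd l i : bool := odd i && (i < l.*2)%N.

Definition rational_off_low_odd l v : Prop :=
  to_circle v`_0 = 0 /\ forall i, ~~ low_odd l i -> torsion (to_circle v`_i).

Lemma odd_poly_form_size_leP l p :
  (odd_poly_form p /\ (size p <= 2 * l)%N) <->
  forall i, ~~ low_odd l i -> p`_i = 0.
Proof.
split=> [[[k [a ->]] sz_p] i|p0].
  rewrite negb_and -leqNgt => /orP[even_i|i_ge]; last first.
    by rewrite nth_default // (leq_trans sz_p) // mul2n.
  rewrite coef_sum big_nat big1 // => j /andP[j0 _]; rewrite coefZ coefXn.
  by case: eqP => [i_eq|_]; rewrite ?mulr0 //; move: even_i; rewrite i_eq; lia.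
split; last by apply/leq_sizeP => i i_ge; apply: p0; rewrite /low_odd; lia.
exists l, (fun j => p`_(2 * j - 1)); apply/polyP => i; rewrite coef_sum.
under eq_bigr => j _ do rewrite coefZ coefXn.
have [/andP[odd_i i_lt]|i_high] := boolP (low_odd l i); last first.
  rewrite p0 // big_nat big1 // => j j_in.
  by case: eqP => [i_eq|_]; rewrite ?mulr0 // mulr1 -i_eq p0.
rewrite (bigD1_seq i./2.+1) ?iota_uniq ?mem_index_iota //=; last by lia.
have <- : i = (2 * i./2.+1 - 1)%N by lia.
rewrite eqxx mulr1 big1 ?addr0 // => j j_neq.
by case: eqP => [i_eq|_]; rewrite ?mulr0 //; move: j_neq; lia.
Qed.

Lemma rational_off_low_oddP l v :
  (exists w : {poly rat}, [/\ w.[0] \is a Num.int,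
     odd_poly_form (v - map_poly ratr w)
   & (size (v - map_poly ratr w)%R <= 2 * l)%N]) <-> rational_off_low_odd l v.
Proof.
split=> [[w [w0 odd_vw sz_vw]]|[v0 v_torsion]].
  have vE i : ~~ low_odd l i -> v`_i = ratr w`_i.
    move: i; have /odd_poly_form_size_leP vw0 := conj odd_vw sz_vw.
    by move=> i /vw0; rewrite coefB coef_map => /eqP; rewrite subr_eq0 => /eqP.
  split=> [|i /vE ->]; last exact: torsion_to_circle_rat.
  rewrite vE //; apply/to_circle_eq0; move: w0; rewrite horner_coef0.
  by move=> /intrP[m ->]; rewrite ratr_int intr_int.
have /choice[q qP] i : exists q : rat, ~~ low_odd l i -> v`_i = ratr q.
  have [_|/v_torsion/torsion_to_circleP[q vq]] := boolP (low_odd l i).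
    by exists 0.
  by exists q.
have vE i : ~~ low_odd l i -> v`_i = ratr (\poly_(i < size v) q i)`_i.
  move=> i_high; rewrite coef_poly; case: ifP => [_|i_ge]; first exact: qP.
  by rewrite rmorph0 nth_default // leqNgt i_ge.
exists (\poly_(i < size v) q i).
have /odd_poly_form_size_leP[odd_vw sz_vw] i : ~~ low_odd l i ->
    (v - map_poly ratr (\poly_(i < size v) q i))`_i = 0.
  by move=> i_high; rewrite coefB coef_map /= -vE // subrr.
split=> //; rewrite horner_coef0; have /to_circle_eq0/intrP[m] := v0.
by rewrite vE // -(ratr_int R) => /(fmorph_inj (@ratr R)) ->; exact: intr_int.
Qed.

End CoefficientCondition.

Lemma mulrz_dvd_eq0 (V : zmodType) (c : V) (N n : int) :
  c *~ N = 0 -> (N %| n)%Z -> c *~ n = 0.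
Proof. by move=> cN /dvdzP[k ->]; rewrite mulrC mulrzA cN mul0rz. Qed.

Lemma to_circle_horner (R : realType) (v : {poly R}) (n : int) :
  to_circle v.[n%:~R] = \sum_(i < size v) to_circle v`_i *~ n ^+ i.
Proof.
rewrite horner_coef raddf_sum; apply: eq_bigr => i _.
by rewrite -to_circle_mulz rmorphXn.
Qed.

Section UlimChar.
Variables (R : realType) (I : Type) (U : ultrafilter_on I).
Implicit Types (c : circle R) (p : ultrafilter_on (I -> int)).

Definition ulim_char c (a : I -> int) : circle R := ulim U (fun i => c *~ a i).

Lemma ulim_char_is_zmod_morphism c : zmod_morphism (ulim_char c).
Proof.
by move=> a b; rewrite -raddfB; apply: eq_ulim => i; rewrite [LHS]mulrzBr.
Qed.

HB.instance Definition _ c := GRing.isZmodMorphism.Build (I -> int) (circle R)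
  (ulim_char c) (ulim_char_is_zmod_morphism c).

Lemma ulim_horner p (v : {poly R}) :
  ulim p (fun x => ulim U (fun i => to_circle v.[(x i)%:~R])) =
  \sum_(e < size v) char_moment p e (ulim_char (to_circle v`_e)) 1.
Proof.
rewrite -(ulim_sum p _ _ (fun (e : 'I_(size v)) x =>
  ulim_char (to_circle v`_e) (1 * x ^+ e))).
apply: eq_ulim => x.
rewrite -(ulim_sum U _ _ (fun (e : 'I_(size v)) i =>
  to_circle v`_e *~ (1 * x ^+ e) i)).
apply: eq_ulim => i; rewrite to_circle_horner.
by apply: eq_bigr => e _; rewrite mul1r exprfctE.
Qed.

Lemma ultra_diff_dvd p (N : int) (l : nat) : N != 0 -> (0 < l)%N ->
  ultra_diff l p [set x : I -> int | U [set i | (N %| x i)%Z]].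
Proof.
move=> N0; case: l => // l _; elim: l => [|l IH].
  rewrite ultra_diffSE.
  have [c cP] := choice (fun x : I -> int => ultra_residue U x N0).
  have [d dP] := ultra_residue p c N0.
  apply: filterS (dP) => x /= c_x; apply: filterS dP => y /= c_y.
  apply: filterS2 (cP x) (cP y) => i /= x_i y_i.
  have -> : (y - x) i = (y i - c y) - (x i - c x) + ((c y - d) - (c x - d)).
    by rewrite -[(y - x) i]/(y i - x i); ring.
  by apply: rpredD; apply: rpredB.
rewrite ultra_diffSE.
apply: filterS (IH) => x /= x_dvd; apply: filterS IH => y /= y_dvd.
apply: filterS2 y_dvd x_dvd => i /= y_i x_i.
by rewrite -[(y - x) i]/(y i - x i) rpredB.
Qed.

Lemma char_moment_diff_torsion p (l e : nat) c :
  (0 < l)%N -> (0 < e)%N -> torsion c ->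
  char_moment (ultra_diff l p) e (ulim_char c) 1 = 0.
Proof.
move=> l0 e0 [N N0 cN]; apply: near_eq0_ulim.
apply: filterS (ultra_diff_dvd p N0 l0) => x /= x_dvd; apply: near_eq0_ulim.
apply: filterS x_dvd => i /= x_i; apply: (mulrz_dvd_eq0 cN).
by rewrite mul1r exprfctE dvdz_exp.
Qed.

Lemma ulim_ultra_diff_horner p (l : nat) (v : {poly R}) :
  (0 < l)%N -> rational_off_low_odd l v ->
  ulim (ultra_diff l p) (fun x => ulim U (fun i => to_circle v.[(x i)%:~R]))
  = 0.
Proof.
move=> l0 [v0 v_torsion]; rewrite ulim_horner big1 // => -[e _] _ /=.
have [/andP[odd_e e_lt]|e_high] := boolP (low_odd l e).
  by rewrite (odd_char_moments_vanish_diff (t := 0)).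
have [->|e0] := posnP e; last exact/char_moment_diff_torsion/v_torsion.
by rewrite v0; apply: ulim_eq0 => x; apply: ulim_eq0 => i; exact: mul0rz.
Qed.

End UlimChar.

Lemma ret_set_Delta_fin_star (R : realType) (l r : nat) (v : {poly R})
    (eps : R) :
  (forall m : nat -> int, exists js, [/\ sorted ltn js, size js = (2 ^ l)%N,
     all (ltn^~ r.+1) js & dist_int v.[(pdiff l (map m js))%:~R] < eps]) ->
  is_Delta_fin_star l r.+1 (ret_set v eps).
Proof.
move=> some_js; split=> [n []//|F [F_pos [n n_F]]].
have [js [js_sorted sz_js js_lt dist_lt]] := some_js (fun k => n (inord k)).
have n_js : Dset l n (pdiff l (map (fun k => n (inord k)) js)).
  exists (map inord js); last by rewrite -map_comp.
  split; first by rewrite size_map.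
  apply: (homo_sorted_in _ js_lt js_sorted) => i j i_lt j_lt /= ij.
  by rewrite ltEord /= !inordK.
exists (pdiff l (map (fun k => n (inord k)) js)).
by split; [split=> //; exact/F_pos/n_F|exact: n_F].
Qed.

(* Applying [ulim_ultra_diff_horner] to the sequences k |-> (r |-> m r k) in the
   ring of functions of r makes the bound on [js] uniform. *)
Lemma exists_return_in_family (R : realType) (l : nat) (v : {poly R}) (eps : R)
    (m : nat -> nat -> int) :
  (0 < l)%N -> rational_off_low_odd l v -> 0 < eps ->
  exists r js, [/\ (2 ^ l <= r)%N, sorted ltn js, size js = (2 ^ l)%N,
    all (ltn^~ r.+1) js & dist_int v.[(pdiff l (map (m r) js))%:~R] < eps].
Proof.
move=> l0 v_rat eps0; have eps20 : 0 < eps / 2 by rewrite divr_gt0.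
pose U := ultra_infty; pose n k : nat -> int := m^~ k.
pose V (x : nat -> int) := ulim U (fun r => to_circle v.[(x r)%:~R]).
have := ulimP (ultra_diff l (ultra_map n U)) V eps20.
rewrite ulim_ultra_diff_horner //.
move=> /(ramsey_ultra_diff (lt := ltn) ultra_infty_gt)[e [e_lt eP]].
pose js := map e (iota 0 (2 ^ l)).
have sz_js : size js = (2 ^ l)%N by rewrite size_map size_iota.
have := eP _ (iota_ltn_sorted 0 (2 ^ l)) (size_iota 0 _); rewrite map_comp -/js.
rewrite /= subr0 => V_small.
have [r [/= r_small [r_ge r_gt]]] := filter_ex (filterI
  (ulimP U (fun r => to_circle v.[(seq_diff l (map n js) r)%:~R]) eps20)
  (filterI (ultra_infty_gt (2 ^ l)) (ultra_infty_gt (e (2 ^ l)%N)))).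
exists r, js; split=> //; first exact: ltnW.
- exact: (homo_sorted e_lt) (iota_ltn_sorted 0 _).
- rewrite all_map; apply/allP => j; rewrite mem_iota /= add0n => /e_lt j_lt.
  by rewrite ltnS ltnW // (ltn_trans j_lt).
have := circle_norm_split r_small V_small; rewrite subrK circle_norm_to_circle.
by rewrite seq_diff_fct -map_comp -pdiffE.
Qed.

Lemma rational_Delta_fin_star (R : realType) (l : nat) (v : {poly R})
    (eps : R) :
  (0 < l)%N -> rational_off_low_odd l v -> 0 < eps ->
  exists r, (2 ^ l <= r)%N /\ is_Delta_fin_star l r (ret_set v eps).
Proof.
move=> l0 v_rat eps0; apply: contrapT => not_star.
have /choice[m mP] r : exists m : nat -> int, (2 ^ l <= r)%N -> ~ exists js,
    [/\ sorted ltn js, size js = (2 ^ l)%N, all (ltn^~ r.+1) js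
      & dist_int v.[(pdiff l (map m js))%:~R] < eps].
  have [r_ge|_] := leqP (2 ^ l) r; last by exists (fun=> 0).
  apply: contrapT => all_return; apply: not_star; exists r.+1.
  split; first exact: leqW.
  apply: ret_set_Delta_fin_star => m; apply: contrapT => no_js.
  by apply: all_return; exists m.
have [r [js [r_ge js_sorted sz_js js_lt js_return]]] :=
  exists_return_in_family m l0 v_rat eps0.
by apply: mP r_ge _; exists js.
Qed.

Lemma ultra_diff_gt (l : nat) (p : ultrafilter_on int) :
  (forall N, p [set n | N < n]) -> forall N, ultra_diff l p [set n | N < n].
Proof.
move=> p_gt; elim: l => [//|l IH] N; rewrite ultra_diffSE.
by apply: filterE => x; apply: filterS (IH (N + x)) => y /=; rewrite ltrBrDr.
Qed.

Lemma increasing_ge (n : nat -> int) :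
  (forall k, 0 < n k) -> {homo n : i j / (i < j)%N >-> i < j} ->
  forall k, k%:Z <= n k.
Proof.
move=> n_gt0 n_lt; elim=> [|k IH]; first exact/ltW.
by have := n_lt k k.+1 (ltnSn k); lia.
Qed.

Lemma Delta_fin_star_Delta_star (l r : nat) (E : set int) :
  is_Delta_fin_star l r E -> is_Delta_star l E.
Proof.
move=> [E_pos E_star]; split=> // n n_pos n_lt.
have n_gt N : ultra_map n ultra_infty [set k | N < k].
  rewrite ultra_mapE; apply: filterS (ultra_infty_gt `|N|) => k /= k_gt.
  by have := increasing_ge n_pos n_lt k; lia.
have [e [e_lt eP]] :=
  ramsey_ultra_diff (lt := ltn) ultra_infty_gt (ultra_diff_gt l n_gt 0).
have val_sorted (js : seq 'I_r) : sorted <%O js -> sorted ltn (map val js).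
  by apply: homo_sorted => i j; rewrite ltEord.
have [|d [Ed [js [sz_js js_sorted] js_d]]] :=
  E_star (Dset l (fun i : 'I_r => n (e i))).
  split; last by exists (fun i : 'I_r => n (e i)).
  move=> _ [js [sz_js js_sorted] <-]; rewrite /posint /= pdiffE.
  have := eP _ (val_sorted _ js_sorted); rewrite size_map -map_comp.
  by apply.
exists d; split=> //; exists (map (e \o val) js); last by rewrite -map_comp.
split; first by rewrite size_map.
by rewrite map_comp; apply: (homo_sorted e_lt); exact: val_sorted.
Qed.

(** * Ultrafilters on the integers *)

Definition divisible_at_oo (p : ultrafilter_on int) : Prop :=
  (forall N, p [set n | N < n]) /\
  (forall N, N != 0 -> p [set n | (N %| n)%Z]).

Section DivisibleAtInfinity.
Implicit Types p q : ultrafilter_on int.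

Lemma fact_dvd_divisible_at_oo (n : nat -> int) :
  (forall i, (i`!)%:Z <= n i /\ ((i`!)%:Z %| n i)%Z) ->
  divisible_at_oo (ultra_map n ultra_infty).
Proof.
move=> nP; split=> N => [|N0]; rewrite ultra_mapE;
  apply: filterS (ultra_infty_gt `|N|) => i /= i_gt; have [n_ge i_dvd] := nP i.
  by have := fact_geq i; lia.
by apply: dvdz_trans i_dvd; rewrite dvdzE /= dvdn_fact // absz_gt0 N0 ltnW.
Qed.

Lemma exists_divisible_at_oo : exists p, divisible_at_oo p.
Proof.
eexists; apply: (fact_dvd_divisible_at_oo (n := fun i => (i`!)%:Z)) => i.
by split.
Qed.

Lemma ultra_add_gt p q (N : int) :
  (forall M, q [set n | M < n]) -> ultra_add p q [set n | N < n].
Proof.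
move=> q_gt; rewrite ultra_addE; apply: filterE => x.
by apply: filterS (q_gt (N - x)) => y /=; rewrite ltrBlDl.
Qed.

Lemma ultra_add_dvd p q (N : int) : p [set n | (N %| n)%Z] ->
  q [set n | (N %| n)%Z] -> ultra_add p q [set n | (N %| n)%Z].
Proof.
move=> p_dvd q_dvd; rewrite ultra_addE; apply: filterS p_dvd => x Nx.
by apply: filterS q_dvd => y Ny; exact: rpredD.
Qed.

Lemma divisible_at_oo_add p q :
  divisible_at_oo p -> divisible_at_oo q -> divisible_at_oo (ultra_add p q).
Proof.
move=> [_ p_dvd] [q_gt q_dvd]; split=> N; first exact: ultra_add_gt.
by move=> N0; apply: ultra_add_dvd; [exact: p_dvd|exact: q_dvd].
Qed.

Lemma divisible_at_oo_diff (l : nat) p :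
  divisible_at_oo p -> divisible_at_oo (ultra_diff l p).
Proof.
move=> p_div; elim: l => //= l [IHgt IHdvd]; split=> N.
  exact: ultra_add_gt.
move=> N0; apply: ultra_add_dvd; last exact: IHdvd.
by rewrite ultra_mapE; apply: filterS (IHdvd N N0) => n; rewrite /= rpredN.
Qed.

Lemma divisible_at_oo_bind (I : Type) (U : ultrafilter_on I)
    (F : I -> ultrafilter_on int) :
  (forall i, divisible_at_oo (F i)) -> divisible_at_oo (ultra_bind U F).
Proof.
move=> F_div; split=> N => [|N0]; rewrite /ultra_bind /=; apply: filterE => i.
  exact: (F_div i).1.
exact: (F_div i).2.
Qed.

End DivisibleAtInfinity.

Lemma ultra_addA (A : zmodType) : associative (@ultra_add A).
Proof.
move=> p q r; apply: ultrafilter_eq; apply/funext => B.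
rewrite !ultra_addE; congr (ultrafilter p _); apply/funext => x.
rewrite -[LHS]/(ultra_add q r _) ultra_addE; congr (ultrafilter q _).
apply/funext => y; congr (ultrafilter r _).
by apply/funext => z; rewrite /= addrA.
Qed.

Lemma ultra_add_bind (I : Type) (A : zmodType) (U : ultrafilter_on I)
    (F : I -> ultrafilter_on A) (p : ultrafilter_on A) :
  ultra_add (ultra_bind U F) p = ultra_bind U (fun i => ultra_add (F i) p).
Proof. exact: ultrafilter_eq. Qed.

Definition ultra_mulrn (A : zmodType) (p : ultrafilter_on A) (k : nat) :
    ultrafilter_on A :=
  iter k (fun q => ultra_add q p) (ultra_principal 0).

Lemma ultra_mulrnS (A : zmodType) (p : ultrafilter_on A) (k : nat) :
  ultra_mulrn p k.+1 = ultra_add (ultra_mulrn p k) p.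
Proof. by []. Qed.

Lemma ultra_mulrn_dvd (p : ultrafilter_on int) (k : nat) (N : int) :
  p [set n | (N %| n)%Z] -> ultra_mulrn p k [set n | (N %| n)%Z].
Proof.
move=> p_dvd; elim: k => [|k IH]; last exact: ultra_add_dvd.
by apply/principal_filterP; exact: dvdz0.
Qed.

Section MomentsBelow.
Variable R : realType.
Implicit Types (p q s z : ultrafilter_on int) (c : circle R).

Definition moments_vanish_below p (i : nat) : Prop :=
  forall e c, (0 < e < i)%N -> moment p e c = 0.

Lemma moments_vanish_belowW p i j :
  (i <= j)%N -> moments_vanish_below p j -> moments_vanish_below p i.
Proof. by move=> ij p0 e c /andP[e0 ei]; rewrite p0 // e0 (leq_trans ei). Qed.

Lemma moment_principal0 e c : (0 < e)%N -> moment (ultra_principal 0) e c = 0.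
Proof. by case: e => // e _; rewrite /moment ulim_principal expr0n. Qed.

Lemma moment_torsion p e c :
  divisible_at_oo p -> (0 < e)%N -> torsion c -> moment p e c = 0.
Proof.
move=> [_ p_dvd] e0 [N N0 cN]; apply: near_eq0_ulim.
by apply: filterS (p_dvd N N0) => n /= Nn; rewrite (mulrz_dvd_eq0 cN) ?dvdz_exp.
Qed.

Lemma moment_bind (I : Type) (U : ultrafilter_on I)
    (F : I -> ultrafilter_on int) e c :
  moment (ultra_bind U F) e c = ulim U (fun i => moment (F i) e c).
Proof. exact: ulim_bind. Qed.

Lemma moment_add_ends p q e c : (0 < e)%N ->
  (forall i, (0 < i < e)%N -> moment p (e - i) (moment q i c) = 0) ->
  moment (ultra_add p q) e c = moment p e c + moment q e c.
Proof.
move=> e0 mixed0; rewrite moment_add.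
pose F i := moment p (e - i) (moment q i c) *+ 'C(e, i).
rewrite (big_ord_ends (F := F)) // => [|i /mixed0]; last first.
  by rewrite /F => ->; rewrite mul0rn.
by rewrite /F bin0 binn !mulr1n subn0 subnn !moment_exp0.
Qed.

Lemma moment_add_vanishl p q e c : (0 < e)%N -> moments_vanish_below p e ->
  moment (ultra_add p q) e c = moment p e c + moment q e c.
Proof.
move=> e0 p0; apply: moment_add_ends => // i /andP[i0 ie].
by rewrite p0 // subn_gt0 ie ltn_subrL i0.
Qed.

Lemma moment_add_vanishr p q e c : (0 < e)%N -> moments_vanish_below q e ->
  moment (ultra_add p q) e c = moment p e c + moment q e c.
Proof.
by move=> e0 q0; apply: moment_add_ends => // i /q0 ->; exact: raddf0.
Qed.

Lemma moment_addC p q e c : moments_vanish_below p e ->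
  moment (ultra_add p q) e c = moment (ultra_add q p) e c.
Proof.
case: e => [|e] p0; first by rewrite !moment_exp0.
by rewrite moment_add_vanishl // moment_add_vanishr // addrC.
Qed.

Lemma moment_add_subr z p q e c :
  (forall i c, (i < e)%N -> moment p i c = moment q i c) ->
  moment (ultra_add z p) e c - moment (ultra_add z q) e c =
  moment p e c - moment q e c.
Proof.
move=> pq; rewrite !moment_add !big_ord_recr /= subnn !moment_exp0 binn !mulr1n.
under eq_bigr => i _ do rewrite pq //.
by rewrite opprD addrACA subrr add0r.
Qed.

Lemma moment_addS_vanishl p q a c : (0 < a)%N -> moments_vanish_below p a ->
  moment (ultra_add p q) a.+1 c =
  moment p a.+1 c + moment p a (moment q 1 c) *+ a.+1 + moment q a.+1 c.
Proof.
case: a => // a _ p0; rewrite moment_add 2!big_ord_recl big_ord_recr /=.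
rewrite big1 ?add0r => [|i _].
  rewrite /bump /= !add1n bin0 bin1 binn !mulr1n subn0 subn1 subnn !moment_exp0.
  by rewrite addrA.
by rewrite p0 ?mul0rn // /bump /= !add1n; have := ltn_ord i; lia.
Qed.

Lemma moment_addS_vanishr p q a c : (0 < a)%N -> moments_vanish_below q a ->
  moment (ultra_add p q) a.+1 c =
  moment p a.+1 c + moment p 1 (moment q a c) *+ a.+1 + moment q a.+1 c.
Proof.
case: a => // a _ q0; rewrite moment_add 2!big_ord_recr big_ord_recl /=.
rewrite big1 ?addr0 => [|i _].
  by rewrite bin0 binn binSn !mulr1n subn0 subSnn subnn !moment_exp0.
by rewrite q0 ?raddf0 ?mul0rn // /bump /= !add1n ltnS ltn_ord.
Qed.

Lemma moment_add_commutator p q a c : (0 < a)%N -> moments_vanish_below p a ->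
  moment (ultra_add p q) a.+1 c - moment (ultra_add q p) a.+1 c =
  (moment p a (moment q 1 c) - moment q 1 (moment p a c)) *+ a.+1.
Proof.
move=> a0 p0; rewrite moment_addS_vanishl // moment_addS_vanishr // mulrnBl.
rewrite [X in X - _]addrAC [X in _ - X]addrAC [X in _ - (X + _)]addrC.
by rewrite opprD addrACA subrr add0r.
Qed.

Lemma moments_vanish_below_mulrn p i k : moments_vanish_below p i ->
  moments_vanish_below (ultra_mulrn p k) i.
Proof.
move=> p0; elim: k => [|k IH] e c /andP[e0 ei]; first exact: moment_principal0.
rewrite ultra_mulrnS moment_add_vanishr //.
  by rewrite IH ?p0 ?addr0 // e0.
exact: moments_vanish_belowW (ltnW ei) p0.
Qed.

Lemma moment_mulrn p i k c : (0 < i)%N -> moments_vanish_below p i ->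
  moment (ultra_mulrn p k) i c = moment p i c *+ k.
Proof.
move=> i0 p0; elim: k => [|k IH]; first exact: moment_principal0.
by rewrite ultra_mulrnS moment_add_vanishr // IH mulrSr.
Qed.

Lemma first_moment_diff1 p c : moment (ultra_diff1 p) 1 c = 0.
Proof.
rewrite moment_diff1 !big_ord_recl big_ord0 /= /bump /= subn0 subnn.
by rewrite !moment_exp0 expr1 mulrN1z mulr1z addr0 addNr.
Qed.

End MomentsBelow.

Section AttainedMoments.
Variable R : realType.
Implicit Types (p q s z : ultrafilter_on int) (c g h : circle R).

(* For M drawn from an ultrafilter along which M c tends to 0 for every c, the
   (M - 1)-fold sum of z + s, followed by z, is a quasi-inverse of s of one
   order more than z: adding s gives the M-fold sum of z + s. *)
Lemma quasi_inverse_step s z i : (0 < i)%N ->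
  divisible_at_oo s -> divisible_at_oo z ->
  moments_vanish_below R (ultra_add z s) i ->
  exists2 z', divisible_at_oo z' & moments_vanish_below R (ultra_add z' s) i.+1.
Proof.
move=> i0 s_div z_div zs0; pose u := ultra_diff 1 s; pose zs := ultra_add z s.
have [u_gt _] : divisible_at_oo u by exact: divisible_at_oo_diff.
have zs_div k : divisible_at_oo (ultra_add (ultra_mulrn zs k) z).
  have [[z_gt z_dvd] [_ zs_dvd]] := (z_div, divisible_at_oo_add z_div s_div).
  split=> N => [|N0]; first exact: ultra_add_gt.
  by apply: ultra_add_dvd (z_dvd N N0); exact/ultra_mulrn_dvd/zs_dvd.
exists (ultra_bind u (fun M => ultra_add (ultra_mulrn zs `|M|.-1) z)).
  exact: divisible_at_oo_bind.
have zs_sum e c : moment (ultra_add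
    (ultra_bind u (fun M => ultra_add (ultra_mulrn zs `|M|.-1) z)) s) e c =
    ulim u (fun M : int => moment (ultra_mulrn zs `|M|) e c).
  rewrite ultra_add_bind moment_bind; apply: near_eq_ulim.
  apply: filterS (u_gt 0) => M /= M_gt0.
  by rewrite -ultra_addA -[in RHS](prednK (n := `|M|%N)) // absz_gt0 gt_eqF.
move=> e c /andP[e0]; rewrite ltnS leq_eqVlt zs_sum => /orP[/eqP ->|ei].
  rewrite -(first_moment_diff1 s (moment zs i c)); apply: near_eq_ulim.
  apply: filterS (u_gt 0) => M /= M_gt0.
  by rewrite moment_mulrn // pmulrn gtz0_abs.
by apply: ulim_eq0 => M; rewrite (moments_vanish_below_mulrn _ zs0) // e0.
Qed.

Lemma exists_quasi_inverse s i : divisible_at_oo s ->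
  exists2 z, divisible_at_oo z & moments_vanish_below R (ultra_add z s) i.
Proof.
move=> s_div; elim: i => [|[|i] [z z_div zs0]].
- by exists s => // e c; rewrite ltn0 andbF.
- by exists s => // -[|e] c.
exact: quasi_inverse_step zs0.
Qed.

Lemma exists_commutator p q a : (0 < a)%N ->
  divisible_at_oo p -> divisible_at_oo q -> moments_vanish_below R p a ->
  exists k, [/\ divisible_at_oo k, moments_vanish_below R k a.+1
    & forall c, moment k a.+1 c =
        (moment p a (moment q 1 c) - moment q 1 (moment p a c)) *+ a.+1].
Proof.
move=> a0 p_div q_div p0.
have [z z_div zqp0] :=
  exists_quasi_inverse a.+2 (divisible_at_oo_add q_div p_div).
have pqC e c : (e <= a)%N ->
    moment (ultra_add p q) e c = moment (ultra_add q p) e c.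
  by move=> ea; apply/moment_addC/moments_vanish_belowW/p0.
have zpqE e c : (0 < e <= a.+1)%N -> moment (ultra_add z (ultra_add p q)) e c =
    moment (ultra_add p q) e c - moment (ultra_add q p) e c.
  move=> e_le; rewrite -(moment_add_subr z); first by rewrite zqp0 ?subr0.
  move=> i d ie; apply: pqC; rewrite -ltnS (leq_trans ie) //.
  by have /andP[] := e_le.
exists (ultra_add z (ultra_add p q)); split.
- by do !apply: divisible_at_oo_add.
- by move=> e c /andP[e0 ea]; rewrite zpqE ?e0 ?(ltnW ea) // pqC // subrr.
- by move=> c; rewrite zpqE ?leqnn // moment_add_commutator.
Qed.

Definition attains_moment (e : nat) g c : Prop :=
  exists p,
    [/\ divisible_at_oo p, moments_vanish_below R p e & moment p e g = c].

Lemma exists_multiple_near g c (d : R) (N : int) :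
  ~ torsion g -> 0 < d -> N != 0 ->
  exists n, [/\ N <= n, (N %| n)%Z & circle_norm (g *~ n - c) < d].
Proof.
move=> g_nt d0 N0; have [p p_div] := exists_divisible_at_oo.
have [u_gt u_dvd] := divisible_at_oo_diff 1 p_div.
have := ulimP (ultra_diff 1 p) (fun n => g *~ n ^+ 1) d0.
rewrite -[ulim _ _]/(moment _ 1 g) first_moment_diff1 => u_small.
have [n [/= + [n_gt Nn]]] :=
  filter_ex (filterI u_small (filterI (u_gt `|N|) (u_dvd N N0))).
rewrite subr0 expr1 => gn_small.
have gn_neq0 : g *~ n != 0.
  apply/eqP => gn0; apply: g_nt; exists n => //; move: n_gt; lia.
have [k k0 gnk] := exists_circle_multiple_near c gn_neq0 gn_small.
exists (n * k); split; [|exact: dvdz_mulr|by rewrite mulrzA].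
by rewrite (le_trans (ler_norm N)) // (le_trans (ltW n_gt)) // ler_peMr //; lia.
Qed.

Lemma attains_first_moment g c : ~ torsion g -> attains_moment 1 g c.
Proof.
move=> g_nt.
have /choice[n nP] (i : nat) : exists n : int, [/\ (i`!)%:Z <= n,
    ((i`!)%:Z %| n)%Z & circle_norm (g *~ n - c) < i.+1%:R^-1].
  by apply: exists_multiple_near; rewrite ?invr_gt0 // eqz_nat -lt0n fact_gt0.
exists (ultra_map n ultra_infty); split; last first.
- by rewrite /moment ulim_map; apply: ulim_infty_eq => i; have [] := nP i.
- by move=> -[|[|e]].
by apply: fact_dvd_divisible_at_oo => i; have [] := nP i.
Qed.

Lemma attains_moment_torsion_dense e g :
  (forall c, torsion c -> attains_moment e g c) ->
  forall c, attains_moment e g c.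
Proof.
move=> attains_torsion c; have [r rP] := choice (torsion_dense c).
have r_torsion k : torsion (r k) by have [] := rP k.
have [p pP] := choice (fun k => attains_torsion _ (r_torsion k)).
exists (ultra_bind ultra_infty p); split.
- by apply: divisible_at_oo_bind => k; have [] := pP k.
- move=> i d i_lt; rewrite moment_bind; apply: ulim_eq0 => k.
  by have [_ + _] := pP k; exact.
rewrite moment_bind; apply: ulim_infty_eq => k.
by have [_ _ ->] := pP k; have [] := rP k.
Qed.

(* If c is torsion, then the commutator of p and q takes the value 0 - (- c) at
   g when p fixes (a + 1) g and q sends (a + 1) g to - c. *)
Lemma attains_momentS a g c : (0 < a)%N ->
  (forall g c, ~ torsion g -> attains_moment a g c) ->
  ~ torsion g -> attains_moment a.+1 g c.
Proof.
move=> a0 IH g_nt; move: c; apply: attains_moment_torsion_dense => c c_torsion.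
have g'_nt : ~ torsion (g *+ a.+1) by move=> /torsion_mulrSn.
have [p [p_div p0 p_g']] := IH _ (g *+ a.+1) g'_nt.
have [q [q_div _ q_g']] := attains_first_moment (- c) g'_nt.
have [k [k_div k0 kE]] := exists_commutator a0 p_div q_div p0.
exists k; split=> //; rewrite kE mulrnBl -!raddfMn /= p_g' q_g'.
by rewrite (moment_torsion p_div a0 (torsionN c_torsion)) sub0r opprK.
Qed.

Lemma attains_moment_nontorsion e g c :
  (0 < e)%N -> ~ torsion g -> attains_moment e g c.
Proof.
case: e => // e _; elim: e g c => [|e IH] g c.
  exact: attains_first_moment.
exact: attains_momentS.
Qed.

Lemma moment_diff1_vanish_below p e c :
  (0 < e)%N -> moments_vanish_below R p e ->
  moment (ultra_diff1 p) e c = moment p e c *~ (-1) ^+ e + moment p e c.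
Proof. by move=> e0 p0; rewrite moment_add_vanishr // moment_opp. Qed.

Lemma moments_vanish_below_diff p i m :
  moments_vanish_below R p i -> moments_vanish_below R (ultra_diff m p) i.
Proof.
move=> p0; elim: m => //= m IH e c /andP[e0 ei].
rewrite moment_diff1_vanish_below //; first by rewrite IH ?mul0rz ?addr0 ?e0.
exact: moments_vanish_belowW (ltnW ei) IH.
Qed.

Lemma moment_diff_even_lead p i m c : moments_vanish_below R p i ->
  (0 < i)%N -> ~~ odd i -> moment (ultra_diff m p) i c = moment p i c *+ 2 ^ m.
Proof.
move=> p0 i0 even_i; elim: m => [//|m IH]; rewrite ultra_diffS.
rewrite moment_diff1_vanish_below //; last exact: moments_vanish_below_diff.
by rewrite IH -signr_odd (negbTE even_i) mulr1z -mulrnDr addnn -mul2n -expnS.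
Qed.

Lemma exists_second_moment g c (t : nat) : ~ torsion g ->
  exists p, [/\ divisible_at_oo p, odd_moments_vanish R p t & moment p 2 g = c].
Proof.
move=> g_nt; have [d d_c] := circle_divisible c (expn_gt0 2 t : (0 < 2 ^ t)%N).
have [q [q_div q0 q_g]] := attains_moment_nontorsion d (isT : (0 < 2)%N) g_nt.
exists (ultra_diff t q); split; first exact: divisible_at_oo_diff.
- move=> e b odd_e lt_e; apply: (odd_moments_vanish_diff (t := 0)) => //.
  by rewrite add0n -addnn ltn_addr.
- by rewrite moment_diff_even_lead // q_g d_c.
Qed.

Lemma moment_add_odd p q t e c : odd t ->
  moments_vanish_below R p t -> odd_moments_vanish R q t.+1 ->
  odd e -> (e <= t)%N -> moment (ultra_add p q) e c = moment p e c.
Proof.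
move=> odd_t p0 q0 odd_e et.
rewrite moment_add big_ord_recl big1 => [|[i i_lt] _].
  by rewrite /= bin0 mulr1n subn0 moment_exp0 addr0.
rewrite /= /bump /= add1n; have [odd_i|even_i] := boolP (odd i.+1).
  by rewrite q0 ?raddf0 ?mul0rn // ltnS (leq_trans i_lt).
rewrite p0 ?mul0rn //; move: odd_e even_i i_lt et; lia.
Qed.

Lemma exists_odd_lead_fixing g h t : odd t -> ~ torsion g ->
  exists p, [/\ divisible_at_oo p, odd_moments_vanish R p t,
    moment p t g = h & moment p 2 g = g].
Proof.
move=> odd_t g_nt; have t0 : (0 < t)%N by case: (t) odd_t.
have [p [p_div p0 p_g]] := attains_moment_nontorsion h t0 g_nt.
have [q [q_div q0 q_g]] := exists_second_moment (g - moment p 2 g) t.+1 g_nt.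
exists (ultra_add p q); split; first exact: divisible_at_oo_add.
- move=> e c odd_e et; rewrite (moment_add_odd _ _ p0) ?(ltnW et) // p0 //.
  by rewrite et andbT; case: (e) odd_e.
- by rewrite (moment_add_odd _ _ p0).
rewrite moment_add !big_ord_recr big_ord0 /= add0r subn0 subnn !moment_exp0.
by rewrite bin0 binn !mulr1n q0 // raddf0 mul0rn addr0 q_g addrC subrK.
Qed.

Lemma second_moment_diff1 p g : moment p 1 (moment p 1 g) = 0 ->
  moment (ultra_diff1 p) 2 g = moment p 2 g *+ 2.
Proof.
move=> p11; rewrite moment_diff1 !big_ord_recr big_ord0 /= p11 !moment_exp0.
rewrite subn0 subnn mul0rz mul0rn add0r addr0 expr0 sqrrN expr1n mulr1z.
by rewrite bin0 binn -mulr2n.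
Qed.

(* Only the term x^n y^2 survives in the expansion of (y - x)^(n + 2). *)
Lemma moment_diff1_odd_lead p n g : odd n -> divisible_at_oo p ->
  odd_moments_vanish R p n -> torsion (moment p n g) ->
  moment (ultra_diff1 p) n.+2 g = - moment p n (moment p 2 g) *+ 'C(n.+2, 2).
Proof.
move=> odd_n p_div p0 pn_torsion; have n0 : (0 < n)%N by case: (n) odd_n.
rewrite moment_diff1; pose F i :=
  moment p (n.+2 - i) (moment p i g) *~ (-1) ^+ (n.+2 - i) *+ 'C(n.+2, i).
rewrite -[LHS]/(\sum_(i < n.+3) F i).
have F_ends : F n.+2 = - F 0%N.
  rewrite /F bin0 binn !mulr1n subnn subn0 !moment_exp0 expr0 mulr1z.
  by rewrite -signr_odd /= odd_n expr1 mulrN1z opprK.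
have F0 i : (0 < i < n.+2)%N -> i != 2 -> F i = 0.
  move=> /andP[i0 i_lt] i2; rewrite /F.
  have [odd_i|even_i] := boolP (odd i); last first.
    by rewrite p0 ?mul0rz ?mul0rn //; move: odd_n even_i i0 i_lt i2; lia.
  have [->|i_n] := eqVneq i n.
    by rewrite moment_torsion ?mul0rz ?mul0rn ?subn_gt0.
  rewrite [moment p i g]p0 ?raddf0 ?mul0rz ?mul0rn //.
  by move: odd_n odd_i i_lt i_n; lia.
rewrite big_ord_recr big_ord_recl /= F_ends addrC addKr.
rewrite (big_only1 (Ordinal (n0 : (1 < n.+1)%N))) //= => [|i i1 _].
  rewrite /bump /F /= add1n !subSS subn0 -signr_odd odd_n expr1 mulrN1z.
  by rewrite mulNrn.
apply: F0; first by rewrite /bump /= add1n ltnS ltn_ord.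
apply: contraNneq i1 => i1; apply/eqP/val_inj; move: i1.
by rewrite /bump /=; lia.
Qed.

Lemma second_moment_diff p t l g : odd t -> divisible_at_oo p ->
  odd_moments_vanish R p t -> torsion (moment p t g) ->
  moment (ultra_diff l p) 2 g = moment p 2 g *+ 2 ^ l.
Proof.
move=> odd_t p_div p0 pt_torsion; elim: l => [//|l IH]; rewrite ultra_diffS.
rewrite second_moment_diff1 ?IH -?mulrnA -?expnSr //.
have [tl1|tl_neq1] := eqVneq (t + l.*2)%N 1%N; last first.
  by apply: (odd_moments_vanish_diff p0) => //; move: odd_t tl_neq1; lia.
have [t1 l0] : t = 1%N /\ l = 0%N by move: odd_t tl1; lia.
by rewrite l0 /= moment_torsion // -t1.
Qed.

Lemma moment_diff_odd_lead t l : odd t -> exists2 K : int, K != 0 &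
  forall p g, divisible_at_oo p -> odd_moments_vanish R p t ->
    torsion (moment p t g) -> moment p 2 g = g ->
    moment (ultra_diff l p) (t + l.*2) g = moment p t g *~ K.
Proof.
move=> odd_t; elim: l => [|l [K K0 IH]].
  by exists 1 => // p g _ _ _ _; rewrite addn0.
set n := (t + l.*2)%N in IH.
exists (- (K * (2 ^ l)%:Z * 'C(n.+2, 2)%:Z)) => [|p g p_div p0 pt_torsion p2].
  by rewrite oppr_eq0 !mulf_neq0 ?eqz_nat // -lt0n ?expn_gt0 // bin_gt0.
have IHp := IH p g p_div p0 pt_torsion p2.
rewrite doubleS !addnS -/n ultra_diffS moment_diff1_odd_lead.
- rewrite (second_moment_diff _ odd_t) // p2 raddfMn /= IHp.
  by rewrite mulrNz !mulrzA -!pmulrn mulNrn.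
- by rewrite oddD odd_t odd_double.
- exact: divisible_at_oo_diff.
- exact: odd_moments_vanish_diff.
- by rewrite IHp; exact: torsionMz.
Qed.

End AttainedMoments.

(** * Necessity *)

Lemma downward_ind (P : nat -> Prop) (n : nat) :
  (forall i, (n <= i)%N -> P i) ->
  (forall j, (forall i, (j < i)%N -> P i) -> P j) -> forall i, P i.
Proof.
move=> P_ge P_step i; move Ek : (n - i)%N => k.
elim/ltn_ind: k i Ek => k IH i Ek; have [/P_ge //|i_lt] := leqP n i.
by apply: P_step => j ij; apply: (IH (n - j)%N); lia.
Qed.

Section Necessity.
Variables (R : realType) (l : nat) (v : {poly R}).
Hypothesis v_star : forall eps : R, 0 < eps -> is_Delta_star l (ret_set v eps).

Lemma Delta_star_ulim (p : ultrafilter_on int) :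
  (forall N, p [set n | N < n]) ->
  ulim (ultra_diff l p) (fun n => to_circle v.[n%:~R]) = 0.
Proof.
move=> p_gt; set t := ulim _ _; apply: circle_norm_eq0 => d d0.
have d20 : 0 < d / 2 by rewrite divr_gt0.
pose lt (i j : int) := (i < j) && (0 < j).
have p_lt i : p [set k | lt i k].
  by apply: filterS2 (p_gt i) (p_gt 0) => k; rewrite /lt /= => -> ->.
have := ulimP (ultra_diff l p) (fun n => to_circle v.[n%:~R]) d20.
rewrite -/t -[X in ultra_diff l X]ultra_map_id.
move=> /(ramsey_ultra_diff p_lt)[e [e_lt eP]].
have [_ /(_ (fun k => e k.+1))[]] := v_star d20.
- by move=> k; have /andP[] := e_lt _ _ (ltn0Sn k).
- by move=> i j ij; have /andP[] := e_lt i.+1 j.+1 ij.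
move=> n [[_ n_return] [js [sz_js js_sorted] js_n]].
have js1_sorted : sorted ltn (map succn js) by rewrite sorted_map.
have := eP _ js1_sorted; rewrite size_map -map_comp -pdiffE => /(_ sz_js).
rewrite -[map _ js]/(map (fun k => e k.+1) js) js_n /= => /circle_normN_lt t_n.
move: n_return; rewrite -circle_norm_to_circle => n_small.
by have := circle_norm_split t_n n_small; rewrite opprB subrK.
Qed.

Lemma Delta_star_moment_eq0 (p : ultrafilter_on int) (j : nat) :
  divisible_at_oo p ->
  (forall i, i != j -> moment (ultra_diff l p) i (to_circle v`_i) = 0) ->
  moment (ultra_diff l p) j (to_circle v`_j) = 0.
Proof.
move=> [p_gt _] others0; have [j_ge|j_lt] := leqP (size v) j.
  by rewrite nth_default // !raddf0.
have := Delta_star_ulim p_gt; under eq_ulim do rewrite to_circle_horner.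
rewrite (ulim_sum _ _ _ (fun (i : 'I_(size v)) n =>
  to_circle v`_i *~ n ^+ i)).
by rewrite (big_only1 (Ordinal j_lt)) // => i i_neq _; exact: others0.
Qed.

Lemma Delta_star_coef0 : to_circle v`_0 = 0.
Proof.
have [s s_div] := exists_divisible_at_oo.
have [z z_div zs0] := exists_quasi_inverse R (size v) s_div.
rewrite -[LHS](moment_exp0 (ultra_diff l (ultra_add z s))).
apply: Delta_star_moment_eq0 => [|i i0]; first exact: divisible_at_oo_add.
have [i_lt|i_ge] := ltnP i (size v); last by rewrite nth_default // !raddf0.
by apply: (moments_vanish_below_diff _ zs0); rewrite lt0n i0.
Qed.

Lemma Delta_star_coef_even j : ~~ odd j -> torsion (to_circle v`_j).
Proof.
move: j; apply: (@downward_ind _ (size v)) => [j j_ge _|j IH even_j].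
  by rewrite nth_default // raddf0; exact: torsion0.
have [->|j0] := posnP j; first by rewrite Delta_star_coef0; exact: torsion0.
apply: contrapT => vj_nt; set m := size v.
have [h _ h_neq0] :
    exists2 h : circle R, torsion h & h *~ (2 ^ (l + m))%:Z <> 0.
  by apply: torsion_mulz_neq0; rewrite eqz_nat -lt0n expn_gt0.
have [p [p_div p0 p_vj]] := attains_moment_nontorsion h j0 vj_nt.
have diffE : ultra_diff l (ultra_diff m p) = ultra_diff (l + m) p.
  by rewrite /ultra_diff iterD.
apply: h_neq0; rewrite -pmulrn -p_vj -(moment_diff_even_lead _ _ p0) // -diffE.
apply: Delta_star_moment_eq0 => [|i i_neq]; first exact: divisible_at_oo_diff.
have [i_ge|i_lt] := leqP (size v) i; first by rewrite nth_default // !raddf0.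
have [->|i0] := posnP i; first by rewrite Delta_star_coef0 raddf0.
rewrite diffE; have [odd_i|even_i] := boolP (odd i).
  apply: (odd_moments_vanish_diff (t := 0)) => //.
  by move: i_lt; rewrite -/m; lia.
have [ij|ji] := ltnP i j.
  by apply: (moments_vanish_below_diff _ p0); rewrite i0.
apply: moment_torsion => //; first exact: divisible_at_oo_diff.
by apply: IH; rewrite // ltn_neqAle eq_sym i_neq.
Qed.

Lemma Delta_star_coef_odd j :
  odd j -> (l.*2 <= j)%N -> torsion (to_circle v`_j).
Proof.
move: j; apply: (@downward_ind _ (size v)) => [j j_ge _ _|j IH odd_j j_high].
  by rewrite nth_default // raddf0; exact: torsion0.
apply: contrapT => vj_nt; pose t := (j - l.*2)%N.
have odd_t : odd t by rewrite oddB // odd_j odd_double.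
have t_l : (t + l.*2)%N = j by rewrite subnK.
have [K K0 leadE] := moment_diff_odd_lead R l odd_t.
have [h h_torsion h_neq0] := torsion_mulz_neq0 R K0.
have [p [p_div p0 p_vj p2_vj]] := exists_odd_lead_fixing h odd_t vj_nt.
apply: h_neq0; rewrite -p_vj -leadE ?p_vj // t_l.
apply: Delta_star_moment_eq0 => // i i_neq.
have [->|i0] := posnP i; first by rewrite Delta_star_coef0 raddf0.
have [odd_i|even_i] := boolP (odd i); last first.
  apply: moment_torsion; [exact: divisible_at_oo_diff|done|].
  exact: Delta_star_coef_even.
have [ij|ji] := ltnP i j.
  by apply: (odd_moments_vanish_diff p0) => //; rewrite t_l.
apply: moment_torsion; [exact: divisible_at_oo_diff|done|].
by apply: IH; rewrite // ?(leq_trans j_high) // ltn_neqAle eq_sym i_neq.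
Qed.

Lemma Delta_star_rational : rational_off_low_odd l v.
Proof.
split=> [|i]; first exact: Delta_star_coef0.
rewrite negb_and -leqNgt; have [odd_i /=|even_i _] := boolP (odd i).
  exact: Delta_star_coef_odd.
exact: Delta_star_coef_even.
Qed.

End Necessity.

Theorem theorem5p1 (R : realType) (l : nat) (hl : (1 <= l)%N) (v : {poly R}) :
  ((exists w : {poly rat},
      [/\ w.[0] \is a Num.int,
          odd_poly_form (v - map_poly ratr w)
        & (size (v - map_poly ratr w)%R <= 2 * l)%N])
   <->
   (forall eps : R, 0 < eps ->
      exists r : nat, (2 ^ l <= r)%N /\ is_Delta_fin_star l r (ret_set v eps)))
  /\
  ((forall eps : R, 0 < eps ->
      exists r : nat, (2 ^ l <= r)%N /\ is_Delta_fin_star l r (ret_set v eps))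
   <->
   (forall eps : R, 0 < eps -> is_Delta_star l (ret_set v eps))).
Proof.
have i_ii : rational_off_low_odd l v -> forall eps : R, 0 < eps ->
    exists r : nat, (2 ^ l <= r)%N /\ is_Delta_fin_star l r (ret_set v eps).
  by move=> v_rational eps; exact: rational_Delta_fin_star.
have ii_iii : (forall eps : R, 0 < eps -> exists r : nat,
      (2 ^ l <= r)%N /\ is_Delta_fin_star l r (ret_set v eps)) ->
    forall eps : R, 0 < eps -> is_Delta_star l (ret_set v eps).
  by move=> v_fin_star eps /v_fin_star[r [_]]; exact: Delta_fin_star_Delta_star.
have iii_i := @Delta_star_rational R l v.
split; split.
- by move=> /rational_off_low_oddP; exact: i_ii.
- by move=> /ii_iii/iii_i/rational_off_low_oddP.
- exact: ii_iii.
- by move=> /iii_i; exact: i_ii.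
Qed.
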